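(* Let $\mathbf X(\cdot,t)=(r(\cdot,t),z(\cdot,t))$, $0\le s\le L(t)$, $t\ge 0$, together with $\mu$, $\kappa$, $c_l(t)$, $c_r(t)$, be a (sufficiently smooth) solution of the sharp-interface system $$\mathbf X_t\cdot\mathbf n=\frac1r\,(r\mu_s)_s,\qquad \mu=(\gamma(\theta)+\gamma''(\theta))\kappa-\frac{\gamma(\theta)z_s+\gamma'(\theta)r_s}{r},\qquad \kappa=-\mathbf X_{ss}\cdot\mathbf n,\quad \mathbf n=(-z_s,r_s),\qquad 0<s<L(t),\ t>0,$$ subject to the contact line condition, the relaxed contact angle condition and the zero-mass flux condition stated in the context. Then the total volume is conserved and the total free energy is dissipated: $$V(\mathbf X(t))\equiv V(\mathbf X(0)),\qquad W(\mathbf X(t_2))\le W(\mathbf X(t_1))\le W(\mathbf X(0)),\qquad t_2\ge t_1\ge 0.$$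
   Context: Setting: an axisymmetric thin film on an axisymmetric curved rigid substrate, described in the half-plane $\{(r,z): r\ge 0\}$. The substrate is generated by a fixed smooth curve $\hat{\mathbf X}(c)=(\hat x(c),\hat y(c))=(\hat r(c),\hat z(c))$ parameterized by arc length $c$, with $\hat x\ge 0$ and unit tangent $\hat{\mathbf X}_c=(\cos\hat\theta,\sin\hat\theta)$. The film/vapor interface is generated by the open curve $\Gamma(t)$ parameterized by its arc length $s\in[0,L(t)]$; subscripts $s,t,c$ denote derivatives. The time derivative $\mathbf X_t$ is taken at fixed $\rho$ in a parameterization $\mathbf X(\rho,t)$ of $\Gamma(t)$ over the fixed interval $\rho\in[0,1]$. The tangent angle $\theta$ is defined by $\mathbf X_s=(r_s,z_s)=(\cos\theta,\sin\theta)$. The surface energy density $\gamma$ is a positive, $2\pi$-periodic $C^2$ function with $\gamma(-\theta)=\gamma(\theta)$. Constants: contact line mobility $\eta\in(0,\infty)$ and $\sigma\in\mathbb R$. Boundary conditions, for $t\ge0$: (i) Contact line condition: $\mathbf X(L(t),t)=\hat{\mathbf X}(c_r(t))$; at $s=0$, either (two contact lines, $r(0,t)>0$) $\mathbf X(0,t)=\hat{\mathbf X}(c_l(t))$, or (only one, outer, contact line) $r(0,t)=0$ and $z_s(0,t)=0$; in the latter case $c_l$ is the constant parameter at which the substrate curve meets the axis, $\hat x(c_l)=0$. (ii) Relaxed contact angle condition: $\frac{dc_r}{dt}=-\eta f(\theta_e^r;\theta_i^r;\sigma)$ and, if $r(0,t)>0$, $\frac{dc_l}{dt}=\eta f(\theta_e^l;\theta_i^l;\sigma)$,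 where $f(\theta_e;\theta_i;\sigma)=\gamma(\theta_e)\cos\theta_i-\gamma'(\theta_e)\sin\theta_i-\sigma$; here $\theta_e^l,\theta_e^r$ are the values of the tangent angle $\theta$ at $s=0$ and $s=L(t)$, and $\theta_i^l=\theta_e^l-\hat\theta(c_l)$, $\theta_i^r=\theta_e^r-\hat\theta(c_r)$. (iii) Zero-mass flux condition: $\mu_s(0,t)=0$ and $\mu_s(L(t),t)=0$. Volume and energy: $$V(\mathbf X(t))=2\pi\int_0^{L(t)} r z r_s\,ds-2\pi\int_{c_l}^{c_r}\hat r\,\hat z\,\hat r_c\,dc,\qquad W(\mathbf X(t))=2\pi\int_0^{L(t)} r\,\gamma(\theta)\,ds-2\pi\sigma\int_{c_l}^{c_r}\hat x(c)\,dc.$$ *)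

(* Defs.v *)
From Stdlib Require Import Reals Lra.
From Coquelicot Require Import Coquelicot.
Open Scope R_scope.

Definition D1 (f : R -> R -> R) (s t : R) : R := Derive (fun u => f u t) s.
Definition D11 (f : R -> R -> R) (s t : R) : R := Derive_n (fun u => f u t) 2 s.

(* [f] is of class C^n in a neighbourhood of the point [(s, t)].  Requiring this
   at every point of a closed region expresses smoothness up to the boundary:
   outside the region [f] is an arbitrary C^n extension, and the values of its
   derivatives on the boundary are the one-sided ones. *)
Definition Cn_near (n : nat) (f : R -> R -> R) (s t : R) : Prop :=
  locally_2d (fun u v => ex_diff_n f n u v) s t.

Record surface_energy (gamma : R -> R) : Prop := {
  gamma_pos : forall x, 0 < gamma x;
  gamma_periodic : forall x, gamma (x + 2 * PI) = gamma x;
  gamma_even : forall x, gamma (- x) = gamma x;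
  gamma_ex_derive2 : forall x, ex_derive_n gamma 1 x /\ ex_derive_n gamma 2 x;
  gamma_C2 : forall x, continuous (Derive_n gamma 2) x
}.

(* The parameter range is an interval [sub_dom], not all of R: a curve in
   [r >= 0] that meets the axis transversally has to stop there. *)
Record substrate := {
  sub_dom : R -> Prop;
  sub_r : R -> R;
  sub_z : R -> R;
  sub_theta : R -> R
}.

Record is_substrate (B : substrate) : Prop := {
  sub_interval : forall a b c,
    sub_dom B a -> sub_dom B b -> a <= c <= b -> sub_dom B c;
  sub_smooth : forall n c, sub_dom B c ->
    locally c (fun x => ex_derive_n (sub_r B) n x /\ ex_derive_n (sub_z B) n x);
  sub_half_plane : forall c, sub_dom B c -> 0 <= sub_r B c;
  sub_tangent : forall c, sub_dom B c ->
    Derive (sub_r B) c = cos (sub_theta B c) /\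
    Derive (sub_z B) c = sin (sub_theta B c)
}.

(* [r z theta kappa mu] are functions of arc length and time, meaningful for
   [0 <= s <= len t] and [0 <= t].  [arc rho t] is the arc length of the point
   with parameter [rho] in [0, 1] at time [t]; thus the parameterization over
   the fixed interval is [(r (arc rho t) t, z (arc rho t) t)]. *)
Record film := {
  r : R -> R -> R;
  z : R -> R -> R;
  theta : R -> R -> R;
  kappa : R -> R -> R;
  mu : R -> R -> R;
  len : R -> R;
  arc : R -> R -> R;
  cl : R -> R;
  cr : R -> R
}.

Record is_film (B : substrate) (F : film) : Prop := {
  len_pos : forall t, 0 <= t -> 0 < len F t;
  film_smooth : forall s t, 0 <= t -> 0 <= s <= len F t ->
    Cn_near 2 (r F) s t /\ Cn_near 2 (z F) s t /\
    Cn_near 1 (theta F) s t /\ Cn_near 2 (mu F) s t;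
  film_half_plane : forall s t, 0 <= t -> 0 < s < len F t -> 0 < r F s t;
  film_tangent : forall s t, 0 <= t -> 0 <= s <= len F t ->
    D1 (r F) s t = cos (theta F s t) /\ D1 (z F) s t = sin (theta F s t);
  arc_smooth : forall rho t, 0 <= t -> 0 <= rho <= 1 -> Cn_near 1 (arc F) rho t;
  arc_ends : forall t, 0 <= t -> arc F 0 t = 0 /\ arc F 1 t = len F t;
  arc_regular : forall rho t, 0 <= t -> 0 <= rho <= 1 -> 0 < D1 (arc F) rho t;
  contact_dom : forall t, 0 <= t -> sub_dom B (cl F t) /\ sub_dom B (cr F t);
  contact_smooth : forall t, 0 <= t -> ex_derive (cl F) t /\ ex_derive (cr F) t
}.

(* [X_t . n] at arc length [arc rho t], with [X_t] taken at fixed [rho]. *)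
Definition normal_velocity (F : film) (rho t : R) : R :=
  let s := arc F rho t in
  Derive (fun tau => r F (arc F rho tau) tau) t * (- D1 (z F) s t)
  + Derive (fun tau => z F (arc F rho tau) tau) t * D1 (r F) s t.

Record evolution_equations (gamma : R -> R) (F : film) : Prop := {
  eq_velocity : forall rho t, 0 < t -> 0 < rho < 1 ->
    let s := arc F rho t in
    normal_velocity F rho t
    = / r F s t * Derive (fun u => r F u t * D1 (mu F) u t) s;
  eq_mu : forall s t, 0 < t -> 0 < s < len F t ->
    let th := theta F s t in
    mu F s t
    = (gamma th + Derive_n gamma 2 th) * kappa F s t
      - (gamma th * D1 (z F) s t + Derive gamma th * D1 (r F) s t) / r F s t;
  eq_kappa : forall s t, 0 < t -> 0 < s < len F t ->
    kappa F s t
    = - (D11 (r F) s t * (- D1 (z F) s t) + D11 (z F) s t * D1 (r F) s t)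
}.

Definition contact_f (gamma : R -> R) (theta_e theta_i sigma : R) : R :=
  gamma theta_e * cos theta_i - Derive gamma theta_e * sin theta_i - sigma.

Definition contact_f_left gamma (B : substrate) (F : film) sigma (t : R) : R :=
  let te := theta F 0 t in
  contact_f gamma te (te - sub_theta B (cl F t)) sigma.

Definition contact_f_right gamma (B : substrate) (F : film) sigma (t : R) : R :=
  let te := theta F (len F t) t in
  contact_f gamma te (te - sub_theta B (cr F t)) sigma.

(* In [bc_left] the alternative is taken at each time separately; [bc_axis_const]
   says that [cl] keeps one and the same value as long as the film has a single
   contact line. *)
Record boundary_conditions (gamma : R -> R) (B : substrate) (F : film)
    (eta sigma : R) : Prop := {
  bc_right : forall t, 0 <= t ->
    r F (len F t) t = sub_r B (cr F t) /\ z F (len F t) t = sub_z B (cr F t);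
  bc_left : forall t, 0 <= t ->
    (0 < r F 0 t /\ r F 0 t = sub_r B (cl F t) /\ z F 0 t = sub_z B (cl F t))
    \/ (r F 0 t = 0 /\ D1 (z F) 0 t = 0 /\ sub_r B (cl F t) = 0);
  bc_axis_const : forall t1 t2, 0 <= t1 -> 0 <= t2 ->
    r F 0 t1 = 0 -> r F 0 t2 = 0 -> cl F t1 = cl F t2;
  bc_angle_right : forall t, 0 <= t ->
    Derive (cr F) t = - eta * contact_f_right gamma B F sigma t;
  bc_angle_left : forall t, 0 <= t -> 0 < r F 0 t ->
    Derive (cl F) t = eta * contact_f_left gamma B F sigma t;
  bc_flux : forall t, 0 <= t ->
    D1 (mu F) 0 t = 0 /\ D1 (mu F) (len F t) t = 0
}.

Definition volume (B : substrate) (F : film) (t : R) : R :=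
  2 * PI * RInt (fun s => r F s t * z F s t * D1 (r F) s t) 0 (len F t)
  - 2 * PI * RInt (fun c => sub_r B c * sub_z B c * Derive (sub_r B) c)
                  (cl F t) (cr F t).

Definition energy (gamma : R -> R) (B : substrate) (F : film) (sigma t : R) : R :=
  2 * PI * RInt (fun s => r F s t * gamma (theta F s t)) 0 (len F t)
  - 2 * PI * sigma * RInt (fun c => sub_r B c) (cl F t) (cr F t).

(* Main.v *)
Require Import Defs.
From Stdlib Require Import Reals Lra Ranalysis5 ClassicalEpsilon.
From Coquelicot Require Import Coquelicot.
Open Scope R_scope.

(** Both claims are balance laws for integrals over the moving interval
[0 <= s <= L(t)].  Write [v] for the time derivative of the generating curve
at fixed arc length, [v_tau] and [v_n] for its tangential and normal
components.  Passing from fixed parameter to fixed arc length adds to the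
velocity only a multiple of the tangent, so the evolution law prescribes [v_n]
as well, in the form [r v_n = (r mu_s)_s] ([flux_divergence]).  The
time derivative of each density is then, up to a sign-definite term, an exact
[s]-derivative:

- volume: [(r z r_s)_t = (r z r_t + r mu_s)_s] ([volume_balance]);
- energy: [(r gamma(theta))_t + r mu_s^2
     = (r (gamma(theta) v_tau + gamma'(theta) v_n) + mu r mu_s)_s]
  ([energy_balance]).

The second identity is the first variation of the anisotropic surface energy:
by the commutation of [s]- and [t]-derivatives and the Frenet formulas, the
divergence of [r (gamma v_tau + gamma' v_n)] is [(r gamma)_t - r mu v_n]
([chemical_potential]), and [r mu v_n = mu (r mu_s)_s].

Besides the dissipation [- r mu_s^2], only boundary terms remain.  At a contact line the film end slides along the
substrate, so its velocity is [dc/dt] times the substrate tangent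
([contact_velocity_right], [contact_velocity_left]); with [mu_s = 0] the
volume terms cancel against the derivative of the substrate integral
([volume_rate_zero]), and each energy term combines with the wetting term into
[r f dc_r/dt] or [- r f dc_l/dt], which the contact angle law turns into
[- eta r f^2] ([energy_rate]).  On the axis every boundary term at the left end carries the
factor [r = 0].

The equations hold for [t > 0] only.  The integrals are differentiable also at
[t = 0], provided that [L] is replaced by the smooth extension [arc 1] to
negative times, so the mean value theorem applies on [[0, t]] and evaluates
the derivative at an interior time. *)

(** * Functions of class C^n near a point *)

(** Tube lemma: by compactness of the segment, neighbourhoods of its points
contain a common rectangle, which moreover overshoots the ends of the segment. *)
Lemma locally_2d_tube (P : R -> R -> Prop) (a b y : R) :
  (forall x, a <= x <= b -> locally_2d P x y) ->
  exists d : posreal, forall u v,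
    a - d <= u <= b + d -> Rabs (v - y) < d -> P u v.
Proof.
intros HP.
destruct (Rle_or_lt a b) as [Hab|Hab].
2:{ exists (mkposreal ((a - b) / 4) ltac:(lra)); simpl; intros u v Hu; lra. }
assert (HP' : forall x, exists d : posreal, a <= x <= b ->
  forall u v, Rabs (u - x) < d -> Rabs (v - y) < d -> P u v).
{ intros x. destruct (classic (a <= x <= b)) as [Hx|Hx].
  - destruct (HP x Hx) as [d Hd]. exists d. intros _. exact Hd.
  - exists (mkposreal 1 Rlt_0_1). intros H; contradiction. }
pose (delta := fun x => proj1_sig (constructive_indefinite_description _ (HP' x))).
assert (Hdelta : forall x, a <= x <= b ->
  forall u v, Rabs (u - x) < delta x -> Rabs (v - y) < delta x -> P u v)
  by (intros x; exact (proj2_sig (constructive_indefinite_description _ (HP' x)))).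
destruct (compactness_value_1d a b (fun x => pos_div_2 (delta x))) as [d Hd].
exists (pos_div_2 d). intros u v Hu Hv.
(* the point of [a, b] closest to u *)
set (x := Rmax a (Rmin b u)).
assert (Hx : a <= x <= b /\ Rabs (u - x) <= d / 2).
{ assert (Hd0 := cond_pos d). unfold x, Rmax, Rmin, Rabs; simpl in Hu.
  destruct (Rle_dec b u); destruct (Rle_dec a _); destruct (Rcase_abs _); lra. }
apply NNPP. intros HnP. apply (Hd x (proj1 Hx)). intros [c [Hc [Hxc Hdc]]].
apply HnP, (Hdelta c Hc); simpl in *; generalize (cond_pos d); intros Hd0.
- replace (u - c) with ((u - x) + (x - c)) by ring.
  apply Rle_lt_trans with (1 := Rabs_triang _ _). lra.
- lra.
Qed.

Lemma locally_1d_2d (P : R -> Prop) (x y : R) :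
  locally x P -> locally_2d (fun u _ => P u) x y.
Proof. intros [d Hd]. exists d. intros u v Hu _. exact (Hd u Hu). Qed.

Lemma continuity_2d_pt_fst (f : R -> R -> R) (x y : R) :
  continuity_2d_pt f x y -> continuous (fun u => f u y) x.
Proof.
intros H P [eps HP]. destruct (H eps) as [d Hd]. exists d. intros u Hu.
apply HP. apply (Hd u y Hu).
rewrite Rminus_eq_0, Rabs_R0. apply cond_pos.
Qed.

Lemma continuity_2d_pt_swap (f : R -> R -> R) (x y : R) :
  continuity_2d_pt f x y -> continuity_2d_pt (fun u v => f v u) y x.
Proof.
intros H eps. destruct (H eps) as [d Hd]. exists d. intros u v Hu Hv. now apply Hd.
Qed.

Definition D2 (f : R -> R -> R) (s t : R) : R := Derive (fun v => f s v) t.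

Lemma Cn_near_locally (n : nat) (f : R -> R -> R) (s t : R) :
  Cn_near n f s t -> locally_2d (Cn_near n f) s t.
Proof. apply locally_2d_impl_strong, locally_2d_forall. intros u v H. exact H. Qed.

Lemma Cn_near_continuity (n : nat) (f : R -> R -> R) (s t : R) :
  Cn_near n f s t -> continuity_2d_pt f s t.
Proof. intros H. apply locally_2d_singleton in H. destruct n; apply H. Qed.

Lemma Cn_near_D1 (n : nat) (f : R -> R -> R) (s t : R) :
  Cn_near (S n) f s t -> Cn_near n (D1 f) s t.
Proof. apply locally_2d_impl, locally_2d_forall. intros u v H. apply H. Qed.

Lemma Cn_near_D2 (n : nat) (f : R -> R -> R) (s t : R) :
  Cn_near (S n) f s t -> Cn_near n (D2 f) s t.
Proof. apply locally_2d_impl, locally_2d_forall. intros u v H. apply H. Qed.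

Lemma Cn_near_S (n : nat) (f : R -> R -> R) (s t : R) :
  Cn_near (S n) f s t -> Cn_near n f s t.
Proof.
apply locally_2d_impl, locally_2d_forall. intros u v.
apply ex_diff_n_m. apply Nat.le_succ_diag_r.
Qed.

Lemma is_derive_D1 (n : nat) (f : R -> R -> R) (s t : R) :
  Cn_near (S n) f s t -> is_derive (fun u => f u t) s (D1 f s t).
Proof. intros H. apply locally_2d_singleton in H. apply Derive_correct, H. Qed.

Lemma is_derive_D2 (n : nat) (f : R -> R -> R) (s t : R) :
  Cn_near (S n) f s t -> is_derive (fun v => f s v) t (D2 f s t).
Proof. intros H. apply locally_2d_singleton in H. apply Derive_correct, H. Qed.

Lemma D1_D2_comm (f : R -> R -> R) (s t : R) :
  Cn_near 2 f s t -> D1 (D2 f) s t = D2 (D1 f) s t.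
Proof.
intros H. apply Schwarz.
- revert H. apply locally_2d_impl, locally_2d_forall.
  intros u v H. simpl in H. tauto.
- apply (Cn_near_continuity 0), (Cn_near_D1 0 (D2 f)), Cn_near_D2, H.
- apply (Cn_near_continuity 0), (Cn_near_D2 0 (D1 f)), Cn_near_D1, H.
Qed.

(** The total derivative of a C^1 function along a moving point. *)
Lemma is_derive_along (f : R -> R -> R) (a : R -> R) (t da : R) :
  Cn_near 1 f (a t) t -> is_derive a t da ->
  is_derive (fun v => f (a v) v) t (D1 f (a t) t * da + D2 f (a t) t).
Proof.
intros Hf Ha.
rewrite <- (Rmult_1_r (D2 f (a t) t)).
apply is_derive_Reals.
apply (derivable_pt_lim_comp_2d f a (fun v => v)).
- apply filterdiff_differentiable_pt_lim.
  apply (is_derive_filterdiff f (a t) t (D1 f) (D2 f (a t) t)).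
  + destruct Hf as [d Hd]. exists d. intros [u v] [Hu Hv].
    apply Derive_correct, (Hd u v Hu Hv).
  + apply (is_derive_D2 0), Hf.
  + apply continuity_2d_pt_filterlim.
    apply (Cn_near_continuity 0), Cn_near_D1, Hf.
- now apply is_derive_Reals.
- apply derivable_pt_lim_id.
Qed.

Lemma C1_continuity (f : R -> R -> R) (s t : R) : Cn_near 1 f s t ->
  continuity_2d_pt f s t /\ continuity_2d_pt (D1 f) s t /\
  continuity_2d_pt (D2 f) s t.
Proof.
intros H. repeat split.
- apply (Cn_near_continuity 1), H.
- apply (Cn_near_continuity 0), Cn_near_D1, H.
- apply (Cn_near_continuity 0), Cn_near_D2, H.
Qed.

Lemma C2_continuity (f : R -> R -> R) (s t : R) : Cn_near 2 f s t ->
  continuity_2d_pt f s t /\ continuity_2d_pt (D1 f) s t /\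
  continuity_2d_pt (D2 f) s t /\ continuity_2d_pt (D1 (D1 f)) s t /\
  continuity_2d_pt (D2 (D1 f)) s t /\ continuity_2d_pt (D1 (D2 f)) s t.
Proof.
intros H. repeat split.
- apply (Cn_near_continuity 2), H.
- apply (Cn_near_continuity 1), Cn_near_D1, H.
- apply (Cn_near_continuity 1), Cn_near_D2, H.
- apply (Cn_near_continuity 0), Cn_near_D1, Cn_near_D1, H.
- apply (Cn_near_continuity 0), Cn_near_D2, Cn_near_D1, H.
- apply (Cn_near_continuity 0), Cn_near_D1, Cn_near_D2, H.
Qed.

(** The relation to [th] is assumed near the point only: the tangent angle
describes the curve inside the film, not in the smooth extension around it. *)
Lemma chain_rule_locally (f th : R -> R -> R) (phi dphi : R -> R) (s t : R) :
  (forall x, is_derive phi x (dphi x)) ->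
  Cn_near 1 th s t ->
  locally_2d (fun u v => f u v = phi (th u v)) s t ->
  D1 f s t = dphi (th s t) * D1 th s t /\
  D2 f s t = dphi (th s t) * D2 th s t.
Proof.
intros Hphi Hth Hf.
assert (H0 : forall d : posreal, Rabs (s - s) < d /\ Rabs (t - t) < d)
  by (intros d; rewrite !Rminus_eq_0, Rabs_R0; split; apply cond_pos).
destruct Hf as [d Hd]. split; apply is_derive_unique.
- apply (is_derive_ext_loc (fun u => phi (th u t))).
  + exists d. intros u Hu. symmetry. apply Hd; [exact Hu|apply H0].
  + rewrite Rmult_comm. apply (is_derive_comp phi (fun u => th u t)); [apply Hphi|].
    apply (is_derive_D1 0), Hth.
- apply (is_derive_ext_loc (fun v => phi (th s v))).
  + exists d. intros v Hv. symmetry. apply Hd; [apply H0|exact Hv].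
  + rewrite Rmult_comm. apply (is_derive_comp phi (fun v => th s v)); [apply Hphi|].
    apply (is_derive_D2 0), Hth.
Qed.

(** The kinematics of a contact line: two descriptions of one moving point,
by the film and by the substrate, give the same velocity. *)
Lemma velocity_of_constrained_point (f : R -> R -> R) (X a c : R -> R) (t dX da : R) :
  Cn_near 1 f (a t) t -> is_derive a t da -> ex_derive c t ->
  is_derive X (c t) dX -> locally t (fun v => f (a v) v = X (c v)) ->
  D1 f (a t) t * da + D2 f (a t) t = dX * Derive c t.
Proof.
intros Hf Ha Hc HX Heqv.
rewrite <- (is_derive_unique _ _ _ (is_derive_along f a t da Hf Ha)).
apply is_derive_unique, (is_derive_ext_loc (fun v => X (c v))).
- revert Heqv. apply filter_imp. intros v H. now symmetry.
- rewrite Rmult_comm. apply (is_derive_comp X c); [exact HX|].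
  apply Derive_correct, Hc.
Qed.

(** [is_derive_unique] types the bound variable in [R_AbsRing], which keeps
[rewrite] from finding the derivative in a goal that has it in [R]. *)
Ltac rewrite_derive H :=
  apply is_derive_unique in H; change (AbsRing.sort R_AbsRing) with R in H;
  rewrite H; clear H.

Ltac cont2 := repeat first
  [ apply continuity_2d_pt_plus | apply continuity_2d_pt_minus
  | apply continuity_2d_pt_mult | apply continuity_2d_pt_opp | eassumption ].

(** * Integrals with moving bounds *)

(** Leibniz rule.  The density is regular in a neighbourhood of the closed
segment, hence on a rectangle around it, where differentiation under the
integral sign and at the moving end both apply. *)
Lemma is_derive_RInt_moving_end (g h : R -> R -> R) (b : R -> R) (t db : R) :
  0 <= b t -> is_derive b t db ->
  (forall s, 0 <= s <= b t -> locally_2d (fun u v =>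
     continuity_2d_pt g u v /\
     is_derive (fun w => g u w) v (h u v) /\ continuity_2d_pt h u v) s t) ->
  is_derive (fun v => RInt (fun s => g s v) 0 (b v)) t
    (RInt (fun s => h s t) 0 (b t) + g (b t) t * db).
Proof.
intros Hb0 Hb Hg.
destruct (locally_2d_tube _ _ _ _ Hg) as [d Hd].
assert (Hd0 := cond_pos d).
assert (Hder : forall s v, 0 - d <= s <= b t + d -> Rabs (v - t) < d ->
  Derive (fun w => g s w) v = h s v)
  by (intros s v Hs Hv; apply is_derive_unique, (Hd s v Hs Hv)).
assert (Hint : forall lo up v, 0 - d <= lo -> lo <= up -> up <= b t + d ->
  Rabs (v - t) < d -> ex_RInt (fun s => g s v) lo up).
{ intros lo up v H1 H2 H3 Hv. apply (ex_RInt_continuous (V := R_CompleteNormedModule)).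
  intros s. rewrite Rmin_left, Rmax_right by lra. intros Hs.
  apply continuity_2d_pt_fst, Hd; [lra|exact Hv]. }
assert (Ht : Rabs (t - t) < d) by (rewrite Rminus_eq_0, Rabs_R0; exact Hd0).
assert (Hcont : forall s v, 0 - d < s < b t + d -> Rabs (v - t) < d ->
  continuity_2d_pt (fun v s => Derive (fun w => g s w) v) v s).
{ intros s v Hs Hv. apply (continuity_2d_pt_ext_loc (fun v s => h s v)).
  - apply Rabs_def2 in Hv.
    assert (He : 0 < Rmin (Rmin (s + d) (b t + d - s)) (Rmin (t + d - v) (v - t + d)))
      by (repeat apply Rmin_glb_lt; lra).
    exists (mkposreal _ He). simpl. intros v' s' Hv' Hs'.
    apply Rmin_Rgt in Hv'. apply Rmin_Rgt in Hs'.
    destruct Hv' as [_ Hv'], Hs' as [Hs' _].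
    apply Rmin_Rgt in Hv'. apply Rmin_Rgt in Hs'.
    destruct Hv' as [Hv1 Hv2], Hs' as [Hs1 Hs2].
    apply Rabs_def2 in Hv1. apply Rabs_def2 in Hv2.
    apply Rabs_def2 in Hs1. apply Rabs_def2 in Hs2.
    symmetry. apply Hder; [lra|]. apply Rabs_def1; lra.
  - apply continuity_2d_pt_swap, Hd; [lra|exact Hv]. }
rewrite (RInt_ext (fun s => h s t) (fun s => Derive (fun w => g s w) t)).
2:{ intros s. rewrite Rmin_left, Rmax_right by lra. intros Hs.
    symmetry. apply Hder; [lra|exact Ht]. }
pose (e := pos_div_2 d).
apply (is_derive_RInt_param_bound_comp_aux3 (fun v s => g s v)).
- exists d. intros v Hv. apply Hint; try lra. exact Hv.
- exists e. exists d. intros v Hv. apply Hint; simpl; try lra. exact Hv.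
- exact Hb.
- exists e. exists d. intros v Hv s Hs. exists (h s v). apply Hd; [|exact Hv].
  revert Hs. unfold Rmin, Rmax; simpl.
  destruct (Rle_dec _ _), (Rle_dec _ _); lra.
- intros s. rewrite Rmin_left, Rmax_right by lra. intros Hs. apply Hcont; [lra|exact Ht].
- exists e. simpl. intros v s Hv Hs. apply Rabs_def2 in Hs.
  apply Hcont; lra.
- apply continuity_pt_filterlim, continuity_2d_pt_fst, Hd; [lra|exact Ht].
Qed.

Lemma is_derive_RInt_bounds (f a b : R -> R) (t da db : R) :
  (forall c, Rmin (a t) (b t) <= c <= Rmax (a t) (b t) ->
     locally c (continuous f)) ->
  is_derive a t da -> is_derive b t db ->
  is_derive (fun v => RInt f (a v) (b v)) t (f (b t) * db - f (a t) * da).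
Proof.
intros Hf Ha Hb.
destruct (locally_2d_tube (fun u _ => continuous f u) _ _ 0
  (fun c Hc => locally_1d_2d _ c 0 (Hf c Hc))) as [d Hd].
assert (H0 := cond_pos d).
assert (Hc : forall u, Rmin (a t) (b t) - d <= u <= Rmax (a t) (b t) + d ->
  continuous f u).
{ intros u Hu. apply (Hd u 0 Hu). rewrite Rminus_eq_0, Rabs_R0. exact H0. }
assert (Hl := Rmin_l (a t) (b t)). assert (Hr := Rmin_r (a t) (b t)).
assert (Hl' := Rmax_l (a t) (b t)). assert (Hr' := Rmax_r (a t) (b t)).
replace (f (b t) * db - f (a t) * da)
  with (minus (scal db (f (b t))) (scal da (f (a t))))
  by (unfold minus, plus, opp, scal; simpl; unfold mult; simpl; ring).
apply (is_derive_RInt_bound_comp f (RInt f)).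
- exists d. intros [u v] [Hu Hv]. simpl in *.
  apply Rabs_def2 in Hu. apply Rabs_def2 in Hv.
  unfold minus, plus, opp in Hu, Hv; simpl in Hu, Hv.
  apply (RInt_correct (V := R_CompleteNormedModule)).
  apply (ex_RInt_continuous (V := R_CompleteNormedModule)).
  intros x [Hx1 Hx2]. apply Hc. split.
  + apply Rle_trans with (2 := Hx1). apply Rmin_glb; lra.
  + apply Rle_trans with (1 := Hx2). apply Rmax_lub; lra.
- apply Hc. lra.
- apply Hc. lra.
- exact Ha.
- exact Hb.
Qed.

Lemma mean_value (f : R -> R) (a b : R) :
  (forall t, a <= t <= b -> ex_derive f t) -> a < b ->
  exists c, a < c < b /\ f b - f a = Derive f c * (b - a).
Proof.
intros Hf Hab.
destruct (MVT_cor2 f (Derive f) a b Hab) as [c [Hc1 Hc2]].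
- intros c Hc. apply is_derive_Reals, Derive_correct, Hf, Hc.
- now exists c.
Qed.

(** * Kinematics of the film *)

Section Film.
Context (gamma : R -> R) (B : substrate) (F : film) (eta sigma : R)
  (Hgamma : surface_energy gamma) (Heta : 0 < eta)
  (HB : is_substrate B) (HF : is_film B F)
  (Heq : evolution_equations gamma F)
  (Hbc : boundary_conditions gamma B F eta sigma).

Lemma is_derive_gamma (x : R) :
  is_derive (fun y => gamma y) x (Derive gamma x).
Proof. apply Derive_correct, (gamma_ex_derive2 _ Hgamma). Qed.

Lemma is_derive_gamma' (x : R) :
  is_derive (fun y => Derive gamma y) x (Derive_n gamma 2 x).
Proof. apply (Derive_correct (Derive gamma)), (gamma_ex_derive2 _ Hgamma). Qed.

Lemma len_arc (t : R) : 0 <= t -> len F t = arc F 1 t.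
Proof. intros Ht. symmetry. apply (arc_ends _ _ HF t Ht). Qed.

Lemma is_derive_arc_end (t : R) :
  0 <= t -> is_derive (arc F 1) t (D2 (arc F) 1 t).
Proof. intros Ht. apply (is_derive_D2 0), (arc_smooth _ _ HF); lra. Qed.

(** The space-time region of the open film is open, because its length is
continuous.  Identities that hold in the film can thus be differentiated there
in both variables. *)
Lemma film_interior (s t : R) : 0 < t -> 0 < s < len F t ->
  locally_2d (fun u v => 0 < v /\ 0 < u < len F v) s t.
Proof.
intros Ht Hs. rewrite len_arc in Hs by lra.
assert (Hc : continuous (arc F 1) t)
  by (apply (ex_derive_continuous (arc F 1)); exists (D2 (arc F) 1 t);
      apply is_derive_arc_end; lra).
assert (He : 0 < (arc F 1 t - s) / 2) by lra.
destruct (proj1 (filterlim_locally (F := locally t) (arc F 1) (arc F 1 t)) Hc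
  (mkposreal _ He)) as [d Hd].
assert (Hm : 0 < Rmin (Rmin (mkposreal _ He) s) (Rmin d t)).
{ repeat apply Rmin_glb_lt; simpl; try lra. apply cond_pos. }
exists (mkposreal _ Hm); simpl. intros u v Hu Hv.
apply Rmin_Rgt in Hu. apply Rmin_Rgt in Hv.
destruct Hu as [Hu _], Hv as [_ Hv].
apply Rmin_Rgt in Hu. apply Rmin_Rgt in Hv.
destruct Hu as [Hu1 Hu2], Hv as [Hv1 Hv2].
specialize (Hd v Hv1).
apply Rabs_def2 in Hd. apply Rabs_def2 in Hu1. apply Rabs_def2 in Hu2.
apply Rabs_def2 in Hv2. unfold minus, plus, opp in Hd; simpl in Hd.
rewrite len_arc by lra. lra.
Qed.

(** The tangent is [(cos theta, sin theta)], hence its first derivatives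
are multiples of the normal [(- sin theta, cos theta)]. *)
Lemma frenet (s t : R) : 0 < t -> 0 < s < len F t ->
  (D1 (D1 (r F)) s t = - sin (theta F s t) * D1 (theta F) s t /\
   D2 (D1 (r F)) s t = - sin (theta F s t) * D2 (theta F) s t) /\
  (D1 (D1 (z F)) s t = cos (theta F s t) * D1 (theta F) s t /\
   D2 (D1 (z F)) s t = cos (theta F s t) * D2 (theta F) s t).
Proof.
intros Ht Hs.
assert (Hth : Cn_near 1 (theta F) s t) by (apply (film_smooth _ _ HF); lra).
assert (Hin := film_interior s t Ht Hs).
split.
- apply (chain_rule_locally (D1 (r F)) (theta F) cos (fun x => - sin x)); [|exact Hth|].
  + intros x. apply is_derive_cos.
  + revert Hin. apply locally_2d_impl, locally_2d_forall. intros u v H.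
    apply (film_tangent _ _ HF); lra.
- apply (chain_rule_locally (D1 (z F)) (theta F) sin cos); [|exact Hth|].
  + intros x. apply is_derive_sin.
  + revert Hin. apply locally_2d_impl, locally_2d_forall. intros u v H.
    apply (film_tangent _ _ HF); lra.
Qed.

Lemma arc_onto (s t : R) : 0 <= t -> 0 < s < len F t ->
  exists rho, 0 < rho < 1 /\ arc F rho t = s.
Proof.
intros Ht Hs. destruct (arc_ends _ _ HF t Ht) as [H0 H1].
destruct (IVT_interv (fun rho => arc F rho t - s) 0 1) as [rho [Hrho Hz]].
- intros rho Hrho. apply continuity_pt_minus; [|apply continuity_pt_const; now intros ? ?].
  apply continuity_pt_filterlim, continuity_2d_pt_fst, (Cn_near_continuity 1).
  now apply (arc_smooth _ _ HF).
- lra.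
- lra.
- lra.
- exists rho. assert (Ha : arc F rho t = s) by lra. split; [|exact Ha].
  destruct (Req_dec rho 0) as [->|]; [lra|].
  destruct (Req_dec rho 1) as [->|]; lra.
Qed.

(** The tangential motion of the parameterization drops out of the normal
velocity, so the evolution law holds with the velocity at fixed arc length,
and at every interior point since [arc] sweeps the whole interval. *)
Lemma flux_divergence (s t : R) : 0 < t -> 0 < s < len F t ->
  D1 (r F) s t * D1 (mu F) s t + r F s t * D1 (D1 (mu F)) s t
  = r F s t * (D2 (z F) s t * cos (theta F s t) - D2 (r F) s t * sin (theta F s t)).
Proof.
intros Ht Hs.
destruct (arc_onto s t ltac:(lra) Hs) as [rho [Hrho Harc]].
assert (Hv := eq_velocity _ _ Heq rho t Ht Hrho). cbv zeta in Hv.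
unfold normal_velocity in Hv. rewrite Harc in Hv.
destruct (film_smooth _ _ HF s t) as [Hr [Hz [_ Hm]]]; try lra.
destruct (film_tangent _ _ HF s t) as [Hrs Hzs]; try lra.
assert (Hr1 : Cn_near 1 (r F) (arc F rho t) t) by (rewrite Harc; apply Cn_near_S, Hr).
assert (Hz1 : Cn_near 1 (z F) (arc F rho t) t) by (rewrite Harc; apply Cn_near_S, Hz).
assert (Hd : is_derive (arc F rho) t (D2 (arc F) rho t))
  by (apply (is_derive_D2 0), (arc_smooth _ _ HF); lra).
assert (Er := is_derive_unique _ _ _ (is_derive_along (r F) (arc F rho) t _ Hr1 Hd)).
assert (Ez := is_derive_unique _ _ _ (is_derive_along (z F) (arc F rho) t _ Hz1 Hd)).
simpl in Er, Ez. rewrite Er, Ez, Harc in Hv.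
assert (Hmul : is_derive (fun u => r F u t * D1 (mu F) u t) s
  (D1 (r F) s t * D1 (mu F) s t + r F s t * D1 (D1 (mu F)) s t)).
{ apply (is_derive_mult (fun u => r F u t) (fun u => D1 (mu F) u t)).
  - now apply (is_derive_D1 1).
  - now apply (is_derive_D1 0), Cn_near_D1.
  - intros; apply Rmult_comm. }
apply is_derive_unique in Hmul. simpl in Hmul. rewrite Hmul in Hv.
assert (Hpos : 0 < r F s t) by (apply (film_half_plane _ _ HF); lra).
apply (f_equal (Rmult (r F s t))) in Hv.
rewrite <- Rmult_assoc, Rinv_r, Rmult_1_l in Hv by lra.
rewrite <- Hv, Hrs, Hzs. ring.
Qed.

Lemma is_derive_substrate (c : R) : sub_dom B c ->
  is_derive (sub_r B) c (cos (sub_theta B c)) /\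
  is_derive (sub_z B) c (sin (sub_theta B c)).
Proof.
intros Hc. destruct (sub_tangent _ HB c Hc) as [<- <-].
destruct (locally_singleton _ _ (sub_smooth _ HB 1%nat c Hc)) as [H1 H2].
split; apply Derive_correct; [exact H1|exact H2].
Qed.

(** The right end is at arc length [L(t)], whose rate of change is that of
[arc 1]; its motion adds a tangential term to the velocity. *)
Lemma contact_velocity_right (t : R) : 0 < t ->
  D1 (r F) (len F t) t * D2 (arc F) 1 t + D2 (r F) (len F t) t
    = cos (sub_theta B (cr F t)) * Derive (cr F) t /\
  D1 (z F) (len F t) t * D2 (arc F) 1 t + D2 (z F) (len F t) t
    = sin (sub_theta B (cr F t)) * Derive (cr F) t.
Proof.
intros Ht.
destruct (contact_dom _ _ HF t ltac:(lra)) as [_ Hdom].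
destruct (contact_smooth _ _ HF t ltac:(lra)) as [_ Hcr].
assert (Hlen := len_pos _ _ HF t ltac:(lra)).
destruct (film_smooth _ _ HF (len F t) t) as [Hr [Hz _]]; try lra.
rewrite len_arc in Hr, Hz |- * by lra.
assert (Hend : locally t (fun v => r F (arc F 1 v) v = sub_r B (cr F v) /\
                                 z F (arc F 1 v) v = sub_z B (cr F v))).
{ generalize (open_gt 0 t Ht). apply filter_imp. intros v Hv.
  rewrite <- len_arc by lra. apply (bc_right _ _ _ _ _ Hbc). lra. }
split; eapply velocity_of_constrained_point.
- apply Cn_near_S, Hr.
- apply is_derive_arc_end. lra.
- exact Hcr.
- apply (is_derive_substrate _ Hdom).
- revert Hend. apply filter_imp. now intros v [H _].
- apply Cn_near_S, Hz.
- apply is_derive_arc_end. lra.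
- exact Hcr.
- apply (is_derive_substrate _ Hdom).
- revert Hend. apply filter_imp. now intros v [_ H].
Qed.

(** Positivity of [r] at the left end persists for nearby times by continuity,
so the film stays attached to the substrate there and the contact condition can
be differentiated. *)
Lemma contact_velocity_left (t : R) : 0 < t -> 0 < r F 0 t ->
  D2 (r F) 0 t = cos (sub_theta B (cl F t)) * Derive (cl F) t /\
  D2 (z F) 0 t = sin (sub_theta B (cl F t)) * Derive (cl F) t.
Proof.
intros Ht Hpos.
destruct (contact_dom _ _ HF t ltac:(lra)) as [Hdom _].
destruct (contact_smooth _ _ HF t ltac:(lra)) as [Hcl _].
assert (Hlen := len_pos _ _ HF t ltac:(lra)).
destruct (film_smooth _ _ HF 0 t) as [Hr [Hz _]]; try lra.
assert (Hend : locally t (fun v => r F 0 v = sub_r B (cl F v) /\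
                                 z F 0 v = sub_z B (cl F v))).
{ assert (Hcont : continuous (fun v => r F 0 v) t).
  { apply (ex_derive_continuous (fun v => r F 0 v)). exists (D2 (r F) 0 t).
    apply (is_derive_D2 1), Hr. }
  generalize (filter_and _ _ (open_gt 0 t Ht) (Hcont _ (open_gt 0 _ Hpos))).
  apply filter_imp. intros v [Hv Hrv].
  destruct (bc_left _ _ _ _ _ Hbc v) as [[_ H]|[H _]]; [lra|exact H|lra]. }
assert (H : D1 (r F) 0 t * 0 + D2 (r F) 0 t
      = cos (sub_theta B (cl F t)) * Derive (cl F) t /\
    D1 (z F) 0 t * 0 + D2 (z F) 0 t
      = sin (sub_theta B (cl F t)) * Derive (cl F) t);
  [|now rewrite !Rmult_0_r, !Rplus_0_l in H].
split; eapply (velocity_of_constrained_point _ _ (fun _ => 0)).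
- apply Cn_near_S, Hr.
- apply (is_derive_const (V := R_NormedModule)).
- exact Hcl.
- apply (is_derive_substrate _ Hdom).
- revert Hend. apply filter_imp. now intros v [H _].
- apply Cn_near_S, Hz.
- apply (is_derive_const (V := R_NormedModule)).
- exact Hcl.
- apply (is_derive_substrate _ Hdom).
- revert Hend. apply filter_imp. now intros v [_ H].
Qed.

(** * Volume balance *)

Definition volume_density (s t : R) := r F s t * z F s t * D1 (r F) s t.
Definition volume_density_rate (s t : R) :=
  D2 (r F) s t * z F s t * D1 (r F) s t + r F s t * D2 (z F) s t * D1 (r F) s t
  + r F s t * z F s t * D2 (D1 (r F)) s t.
Definition volume_flux (s t : R) :=
  r F s t * z F s t * D2 (r F) s t + r F s t * D1 (mu F) s t.

Lemma volume_density_regular (s t : R) : 0 <= t -> 0 <= s <= len F t ->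
  locally_2d (fun u v => continuity_2d_pt volume_density u v /\
    is_derive (fun w => volume_density u w) v (volume_density_rate u v) /\
    continuity_2d_pt volume_density_rate u v) s t.
Proof.
intros Ht Hs. destruct (film_smooth _ _ HF s t Ht Hs) as [Hr [Hz _]].
generalize (locally_2d_and _ _ _ _ (Cn_near_locally _ _ _ _ Hr) (Cn_near_locally _ _ _ _ Hz)).
apply locally_2d_impl, locally_2d_forall. clear. intros s t [Hr Hz].
destruct (C2_continuity _ _ _ Hr) as (? & ? & ? & ? & ? & ?).
destruct (C2_continuity _ _ _ Hz) as (? & ? & ? & ? & ? & ?).
assert (Er := is_derive_D2 1 _ _ _ Hr).
assert (Ez := is_derive_D2 1 _ _ _ Hz).
assert (Ers := is_derive_D2 0 _ _ _ (Cn_near_D1 1 _ _ _ Hr)).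
unfold volume_density, volume_density_rate. refine (conj _ (conj _ _)); [cont2| |cont2].
auto_derive; [repeat split; eexists; eassumption|].
rewrite_derive Er. rewrite_derive Ez. rewrite_derive Ers.
ring.
Qed.

Lemma RInt_film (f : R -> R -> R) (t : R) : 0 <= t ->
  (forall s, 0 <= s <= len F t -> continuity_2d_pt f s t) ->
  ex_RInt (fun s => f s t) 0 (len F t).
Proof.
intros Ht Hf. apply (ex_RInt_continuous (V := R_CompleteNormedModule)).
intros s. assert (Hlen := len_pos _ _ HF t Ht).
rewrite Rmin_left, Rmax_right by lra. intros Hs.
now apply continuity_2d_pt_fst, Hf.
Qed.

(** The derivative of the flux is needed up to the ends of the film, where the
equations may fail; the balance itself is needed only inside, as two points do
not affect an integral. *)
Lemma RInt_of_flux (Q q h : R -> R -> R) (t : R) : 0 <= t ->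
  (forall s, 0 <= s <= len F t ->
    is_derive (fun u => Q u t) s (q s t) /\ continuity_2d_pt q s t) ->
  (forall s, 0 < s < len F t -> h s t = q s t) ->
  RInt (fun s => h s t) 0 (len F t) = Q (len F t) t - Q 0 t.
Proof.
intros Ht HQ Hh. assert (Hlen := len_pos _ _ HF t Ht).
rewrite (RInt_ext _ (fun s => q s t)).
- apply is_RInt_unique.
  apply (is_RInt_derive (V := R_CompleteNormedModule) (fun s => Q s t) (fun s => q s t));
    intros s; rewrite Rmin_left, Rmax_right by lra; intros Hs.
  + apply HQ, Hs.
  + apply continuity_2d_pt_fst, HQ, Hs.
- intros s. rewrite Rmin_left, Rmax_right by lra. apply Hh.
Qed.

(** After the mixed derivatives of [r] cancel, the identity of the integrands is
the evolution law multiplied by [r]. *)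
Lemma volume_balance (t : R) : 0 < t ->
  RInt (fun s => volume_density_rate s t) 0 (len F t)
  = volume_flux (len F t) t - volume_flux 0 t.
Proof.
intros Ht.
apply (RInt_of_flux _ (fun s t =>
  D1 (r F) s t * z F s t * D2 (r F) s t + r F s t * D1 (z F) s t * D2 (r F) s t
  + r F s t * z F s t * D1 (D2 (r F)) s t
  + (D1 (r F) s t * D1 (mu F) s t + r F s t * D1 (D1 (mu F)) s t))); [lra| |].
- intros s Hs. destruct (film_smooth _ _ HF s t ltac:(lra) Hs) as [Hr [Hz [_ Hm]]].
  destruct (C2_continuity _ _ _ Hr) as (? & ? & ? & ? & ? & ?).
  destruct (C2_continuity _ _ _ Hz) as (? & ? & ? & ? & ? & ?).
  destruct (C2_continuity _ _ _ Hm) as (? & ? & ? & ? & ? & ?).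
  split; [|cont2].
  assert (Er := is_derive_D1 1 _ _ _ Hr).
  assert (Ez := is_derive_D1 1 _ _ _ Hz).
  assert (Ert := is_derive_D1 0 _ _ _ (Cn_near_D2 1 _ _ _ Hr)).
  assert (Ems := is_derive_D1 0 _ _ _ (Cn_near_D1 1 _ _ _ Hm)).
  unfold volume_flux. auto_derive; [repeat split; eexists; eassumption|].
  rewrite_derive Er. rewrite_derive Ez. rewrite_derive Ert. rewrite_derive Ems.
  ring.
- intros s Hs. rewrite flux_divergence by assumption.
  destruct (film_smooth _ _ HF s t) as [Hr _]; try lra.
  destruct (film_tangent _ _ HF s t) as [Hrs Hzs]; try lra.
  rewrite D1_D2_comm by exact Hr. unfold volume_density_rate.
  rewrite Hrs, Hzs. ring.
Qed.

(** * Energy balance *)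

Definition energy_density (s t : R) := r F s t * gamma (theta F s t).
Definition energy_density_rate (s t : R) :=
  D2 (r F) s t * gamma (theta F s t)
  + r F s t * (Derive gamma (theta F s t) * D2 (theta F) s t).
Definition tangential_speed (s t : R) :=
  D2 (r F) s t * cos (theta F s t) + D2 (z F) s t * sin (theta F s t).
Definition normal_speed (s t : R) :=
  D2 (z F) s t * cos (theta F s t) - D2 (r F) s t * sin (theta F s t).
(** The first summand is the boundary term of the first variation of the
surface energy; the second one comes from integrating [mu (r mu_s)_s] by parts. *)
Definition energy_flux (s t : R) :=
  r F s t * (gamma (theta F s t) * tangential_speed s t
             + Derive gamma (theta F s t) * normal_speed s t)
  + mu F s t * (r F s t * D1 (mu F) s t).
Definition dissipation (s t : R) := r F s t * D1 (mu F) s t ^ 2.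

Lemma theta_functions_continuity (s t : R) : continuity_2d_pt (theta F) s t ->
  continuity_2d_pt (fun u v => gamma (theta F u v)) s t /\
  continuity_2d_pt (fun u v => Derive gamma (theta F u v)) s t /\
  continuity_2d_pt (fun u v => Derive_n gamma 2 (theta F u v)) s t /\
  continuity_2d_pt (fun u v => cos (theta F u v)) s t /\
  continuity_2d_pt (fun u v => sin (theta F u v)) s t.
Proof.
intros H.
refine (conj _ (conj _ (conj _ (conj _ _))));
  (apply continuity_1d_2d_pt_comp; [|exact H]).
- apply continuity_pt_filterlim, (ex_derive_continuous gamma).
  eexists; apply is_derive_gamma.
- apply continuity_pt_filterlim, (ex_derive_continuous (Derive gamma)).
  eexists; apply is_derive_gamma'.
- apply continuity_pt_filterlim, (gamma_C2 _ Hgamma).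
- apply continuity_cos.
- apply continuity_sin.
Qed.

Lemma energy_density_regular (s t : R) : 0 <= t -> 0 <= s <= len F t ->
  locally_2d (fun u v => continuity_2d_pt energy_density u v /\
    is_derive (fun w => energy_density u w) v (energy_density_rate u v) /\
    continuity_2d_pt energy_density_rate u v) s t.
Proof.
intros Ht Hs. destruct (film_smooth _ _ HF s t Ht Hs) as [Hr [_ [Hth _]]].
generalize (locally_2d_and _ _ _ _ (Cn_near_locally _ _ _ _ Hr) (Cn_near_locally _ _ _ _ Hth)).
apply locally_2d_impl, locally_2d_forall. clear s t Ht Hs Hr Hth. intros s t [Hr Hth].
destruct (C2_continuity _ _ _ Hr) as (? & ? & ? & ? & ? & ?).
destruct (C1_continuity _ _ _ Hth) as (Hc & ? & ?).
destruct (theta_functions_continuity _ _ Hc) as (? & ? & ? & ? & ?).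
assert (Er := is_derive_D2 1 _ _ _ Hr).
assert (Eth := is_derive_D2 0 _ _ _ Hth).
assert (Eg := is_derive_gamma (theta F s t)).
unfold energy_density, energy_density_rate.
refine (conj _ (conj _ _)); [cont2| |cont2].
auto_derive; [repeat split; eexists; eassumption|].
rewrite_derive Er. rewrite_derive Eth. rewrite_derive Eg.
ring.
Qed.

(** The stiffness [gamma + gamma''] arises here: rotating the frame
(tangent, normal) turns [gamma v_tau] into [gamma v_n theta_s] and cancels the
[gamma' v_tau theta_s] that the change of [gamma (theta)] produces. *)
Lemma energy_flux_derivative (s t : R) : 0 <= t -> 0 <= s <= len F t ->
  let th := theta F s t in
  is_derive (fun u => energy_flux u t) s
  (D1 (r F) s t * (gamma th * tangential_speed s t + Derive gamma th * normal_speed s t)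
  + r F s t * ((gamma th + Derive_n gamma 2 th) * normal_speed s t * D1 (theta F) s t
     + gamma th * (D1 (D2 (r F)) s t * cos th + D1 (D2 (z F)) s t * sin th)
     + Derive gamma th * (D1 (D2 (z F)) s t * cos th - D1 (D2 (r F)) s t * sin th))
  + D1 (mu F) s t * (r F s t * D1 (mu F) s t)
  + mu F s t * (D1 (r F) s t * D1 (mu F) s t + r F s t * D1 (D1 (mu F)) s t)).
Proof.
intros Ht Hs th. destruct (film_smooth _ _ HF s t Ht Hs) as [Hr [Hz [Hth Hm]]].
assert (Er := is_derive_D1 1 _ _ _ Hr).
assert (Ert := is_derive_D1 0 _ _ _ (Cn_near_D2 1 _ _ _ Hr)).
assert (Ezt := is_derive_D1 0 _ _ _ (Cn_near_D2 1 _ _ _ Hz)).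
assert (Eth := is_derive_D1 0 _ _ _ Hth).
assert (Em := is_derive_D1 1 _ _ _ Hm).
assert (Ems := is_derive_D1 0 _ _ _ (Cn_near_D1 1 _ _ _ Hm)).
assert (Eg := is_derive_gamma (theta F s t)).
assert (Eg' := is_derive_gamma' (theta F s t)).
unfold energy_flux, tangential_speed, normal_speed.
auto_derive; [repeat split; eexists; eassumption|].
rewrite_derive Er. rewrite_derive Ert. rewrite_derive Ezt. rewrite_derive Eth.
rewrite_derive Em. rewrite_derive Ems. rewrite_derive Eg. rewrite_derive Eg'.
fold th. ring.
Qed.

(** The definition of [mu] cleared of its denominator, with the curvature
[kappa = - theta_s] inserted. *)
Lemma chemical_potential (s t : R) : 0 < t -> 0 < s < len F t ->
  let th := theta F s t in
  r F s t * mu F s t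
  = - r F s t * (gamma th + Derive_n gamma 2 th) * D1 (theta F) s t
    - (gamma th * sin th + Derive gamma th * cos th).
Proof.
intros Ht Hs th.
assert (Hpos : 0 < r F s t) by (apply (film_half_plane _ _ HF); lra).
destruct (frenet s t Ht Hs) as [[Hrss _] [Hzss _]].
destruct (film_tangent _ _ HF s t) as [Hrs Hzs]; try lra.
assert (Hk := eq_kappa _ _ Heq s t Ht Hs).
change (D11 (r F) s t) with (D1 (D1 (r F)) s t) in Hk.
change (D11 (z F) s t) with (D1 (D1 (z F)) s t) in Hk.
rewrite Hrss, Hzss, Hrs, Hzs in Hk. fold th in Hk.
assert (Hk' : kappa F s t = - D1 (theta F) s t).
{ rewrite Hk. generalize (sin2_cos2 th). unfold Rsqr. intros Hsc.
  transitivity (- ((sin th * sin th + cos th * cos th) * D1 (theta F) s t)); [ring|].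
  rewrite Hsc. ring. }
rewrite (eq_mu _ _ Heq s t Ht Hs). fold th. rewrite Hk', Hrs, Hzs. fold th.
field. lra.
Qed.

(** The mixed derivatives of the position are [theta_t] times the normal, so
inside [energy_flux_derivative] they reproduce [r gamma' theta_t]; what
multiplies the normal velocity apart from [r_t gamma] is [- r mu], and cancels
against [mu (r mu_s)_s = r mu v_n]. *)
Lemma energy_balance (t : R) : 0 < t ->
  RInt (fun s => energy_density_rate s t + dissipation s t) 0 (len F t)
  = energy_flux (len F t) t - energy_flux 0 t.
Proof.
intros Ht.
eapply (RInt_of_flux _ (fun s t => let th := theta F s t in _)
  (fun s t => energy_density_rate s t + dissipation s t)); [lra| |].
- intros s Hs. split; [apply energy_flux_derivative; lra|].
  destruct (film_smooth _ _ HF s t ltac:(lra) Hs) as [Hr [Hz [Hth Hm]]].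
  destruct (C2_continuity _ _ _ Hr) as (? & ? & ? & ? & ? & ?).
  destruct (C2_continuity _ _ _ Hz) as (? & ? & ? & ? & ? & ?).
  destruct (C2_continuity _ _ _ Hm) as (? & ? & ? & ? & ? & ?).
  destruct (C1_continuity _ _ _ Hth) as (Hc & ? & ?).
  destruct (theta_functions_continuity _ _ Hc) as (? & ? & ? & ? & ?).
  unfold tangential_speed, normal_speed. cbv zeta. cont2.
- intros s Hs.
  destruct (film_smooth _ _ HF s t) as [Hr [Hz _]]; try lra.
  destruct (film_tangent _ _ HF s t) as [Hrs Hzs]; try lra.
  destruct (frenet s t Ht Hs) as [[_ Hrst] [_ Hzst]].
  assert (Hmu := chemical_potential s t Ht Hs).
  rewrite flux_divergence by assumption. cbv zeta in *.
  rewrite (D1_D2_comm (r F)), (D1_D2_comm (z F)) by assumption.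
  rewrite Hrst, Hzst, Hrs. unfold energy_density_rate, dissipation, tangential_speed, normal_speed.
  generalize (sin2_cos2 (theta F s t)). unfold Rsqr. intros Hsc.
  (* insert the factor 1 = sin^2 + cos^2 where the frame identity is used *)
  transitivity (D2 (r F) s t * gamma (theta F s t) * 1
    + r F s t * (Derive gamma (theta F s t) * D2 (theta F) s t) * 1
    + r F s t * D1 (mu F) s t ^ 2); [ring|].
  rewrite <- Hsc.
  match goal with |- _ = _ + mu F s t * (r F s t * ?v) =>
    replace (mu F s t * (r F s t * v)) with (r F s t * mu F s t * v) by ring end.
  rewrite Hmu. ring.
Qed.

(** * Rates of change of volume and energy *)

Lemma sub_dom_between (t c : R) : 0 <= t ->
  Rmin (cl F t) (cr F t) <= c <= Rmax (cl F t) (cr F t) -> sub_dom B c.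
Proof.
intros Ht. destruct (contact_dom _ _ HF t Ht) as [Hl Hr].
unfold Rmin, Rmax. destruct (Rle_dec _ _); intros Hc.
- now apply (sub_interval _ HB (cl F t) (cr F t)).
- now apply (sub_interval _ HB (cr F t) (cl F t)).
Qed.

Lemma substrate_continuous (c : R) : sub_dom B c ->
  locally c (fun x => continuous (sub_r B) x /\ continuous (sub_z B) x /\
                      continuous (Derive (sub_r B)) x).
Proof.
intros Hc.
generalize (filter_and _ _ (sub_smooth _ HB 1%nat c Hc) (sub_smooth _ HB 2%nat c Hc)).
apply filter_imp. intros x [[H1 H2] [H3 _]].
refine (conj _ (conj _ _)).
- apply (ex_derive_continuous (sub_r B)), H1.
- apply (ex_derive_continuous (sub_z B)), H2.
- apply (ex_derive_continuous (Derive (sub_r B))), H3.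
Qed.

Lemma is_derive_substrate_RInt (f : R -> R) (t : R) : 0 <= t ->
  (forall c, sub_dom B c -> locally c (continuous f)) ->
  is_derive (fun v => RInt f (cl F v) (cr F v)) t
    (f (cr F t) * Derive (cr F) t - f (cl F t) * Derive (cl F) t).
Proof.
intros Ht Hf. destruct (contact_smooth _ _ HF t Ht) as [Hl Hr].
apply is_derive_RInt_bounds; [|apply Derive_correct, Hl|apply Derive_correct, Hr].
intros c Hc. now apply Hf, (sub_dom_between t).
Qed.

Lemma is_derive_film_RInt (g h : R -> R -> R) (t : R) : 0 <= t ->
  (forall s, 0 <= s <= len F t -> locally_2d (fun u v =>
     continuity_2d_pt g u v /\
     is_derive (fun w => g u w) v (h u v) /\ continuity_2d_pt h u v) s t) ->
  is_derive (fun v => RInt (fun s => g s v) 0 (arc F 1 v)) t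
    (RInt (fun s => h s t) 0 (len F t) + g (len F t) t * D2 (arc F) 1 t).
Proof.
intros Ht Hg. assert (Hlen := len_pos _ _ HF t Ht).
rewrite len_arc in Hg, Hlen |- * by exact Ht.
apply is_derive_RInt_moving_end; [lra| |exact Hg].
apply is_derive_arc_end, Ht.
Qed.

(** [volume] and [energy] with [arc 1] in place of the length: the two agree for
[0 <= t], but nothing is known about the length at negative times, while
[arc 1] is differentiable also at [t = 0]. *)
Definition arc_volume (v : R) :=
  2 * PI * RInt (fun s => volume_density s v) 0 (arc F 1 v)
    - 2 * PI * RInt (fun c => sub_r B c * sub_z B c * Derive (sub_r B) c)
                    (cl F v) (cr F v).
Definition arc_energy (v : R) :=
  2 * PI * RInt (fun s => energy_density s v) 0 (arc F 1 v)
    - 2 * PI * sigma * RInt (fun c => sub_r B c) (cl F v) (cr F v).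

Lemma volume_arc_volume (t : R) : 0 <= t -> volume B F t = arc_volume t.
Proof. intros Ht. unfold volume. now rewrite len_arc. Qed.

Lemma energy_arc_energy (t : R) : 0 <= t -> energy gamma B F sigma t = arc_energy t.
Proof. intros Ht. unfold energy. now rewrite len_arc. Qed.

Lemma is_derive_volume (t : R) : 0 <= t ->
  is_derive arc_volume t
  (2 * PI * (RInt (fun s => volume_density_rate s t) 0 (len F t)
             + volume_density (len F t) t * D2 (arc F) 1 t)
   - 2 * PI * (sub_r B (cr F t) * sub_z B (cr F t) * Derive (sub_r B) (cr F t)
                 * Derive (cr F) t
               - sub_r B (cl F t) * sub_z B (cl F t) * Derive (sub_r B) (cl F t)
                 * Derive (cl F) t)).
Proof.
intros Ht.
apply (is_derive_minus (V := R_NormedModule)).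
- apply (is_derive_scal (fun v => RInt (fun s => volume_density s v) 0 (arc F 1 v))).
  apply is_derive_film_RInt; [exact Ht|]. intros s Hs. now apply volume_density_regular.
- apply (is_derive_scal (fun v => RInt _ (cl F v) (cr F v))).
  apply (is_derive_substrate_RInt (fun c => sub_r B c * sub_z B c * Derive (sub_r B) c));
    [exact Ht|].
  intros c Hc. generalize (substrate_continuous c Hc). apply filter_imp.
  intros x (H1 & H2 & H3).
  apply (continuous_mult (fun c => sub_r B c * sub_z B c) (Derive (sub_r B))); [|exact H3].
  now apply (continuous_mult (sub_r B) (sub_z B)).
Qed.

Lemma is_derive_energy (t : R) : 0 <= t ->
  is_derive arc_energy t
  (2 * PI * (RInt (fun s => energy_density_rate s t) 0 (len F t)
             + energy_density (len F t) t * D2 (arc F) 1 t)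
   - 2 * PI * sigma * (sub_r B (cr F t) * Derive (cr F) t
                       - sub_r B (cl F t) * Derive (cl F) t)).
Proof.
intros Ht.
apply (is_derive_minus (V := R_NormedModule)).
- apply (is_derive_scal (fun v => RInt (fun s => energy_density s v) 0 (arc F 1 v))).
  apply is_derive_film_RInt; [exact Ht|]. intros s Hs. now apply energy_density_regular.
- apply (is_derive_scal (fun v => RInt _ (cl F v) (cr F v))).
  apply (is_derive_substrate_RInt (sub_r B)); [exact Ht|].
  intros c Hc. generalize (substrate_continuous c Hc). apply filter_imp.
  now intros x (H1 & _).
Qed.

(** The slice of film that a contact line passes over is the slice that it adds
to or removes from the substrate integral. *)
Lemma volume_rate_zero (t : R) : 0 < t ->
  Derive arc_volume t = 0.
Proof.
intros Ht.
rewrite (is_derive_unique _ _ _ (is_derive_volume t ltac:(lra))).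
rewrite volume_balance by exact Ht.
destruct (contact_dom _ _ HF t ltac:(lra)) as [Hdl Hdr].
destruct (bc_right _ _ _ _ _ Hbc t ltac:(lra)) as [HrR HzR].
destruct (bc_flux _ _ _ _ _ Hbc t ltac:(lra)) as [Hm0 HmL].
destruct (contact_velocity_right t Ht) as [Hvr _].
destruct (sub_tangent _ HB _ Hdl) as [HdR _].
destruct (sub_tangent _ HB _ Hdr) as [HdR' _].
assert (Hright : volume_flux (len F t) t + volume_density (len F t) t * D2 (arc F) 1 t
  = sub_r B (cr F t) * sub_z B (cr F t) * Derive (sub_r B) (cr F t) * Derive (cr F) t).
{ rewrite HdR', <- HrR, <- HzR, Rmult_assoc, <- Hvr.
  unfold volume_flux, volume_density. rewrite HmL. ring. }
assert (Hleft : volume_flux 0 t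
  = sub_r B (cl F t) * sub_z B (cl F t) * Derive (sub_r B) (cl F t) * Derive (cl F) t).
{ unfold volume_flux. rewrite Hm0.
  destruct (bc_left _ _ _ _ _ Hbc t ltac:(lra)) as [[Hpos [HrL HzL]]|[HrL [_ HcL]]].
  - destruct (contact_velocity_left t Ht Hpos) as [Hvl _].
    rewrite HdR, Hvl, HrL, HzL. ring.
  - rewrite HrL, HcL. ring. }
rewrite <- Hright, <- Hleft. ring.
Qed.

Lemma ex_RInt_dissipation (t : R) : 0 <= t ->
  ex_RInt (fun s => dissipation s t) 0 (len F t).
Proof.
intros Ht. apply RInt_film; [exact Ht|]. intros s Hs.
destruct (film_smooth _ _ HF s t Ht Hs) as [Hr [_ [_ Hm]]].
destruct (C2_continuity _ _ _ Hr) as (? & _).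
destruct (C2_continuity _ _ _ Hm) as (_ & ? & _).
unfold dissipation. simpl. cont2. apply continuity_2d_pt_const.
Qed.

(** At an end the terms of the flux, the length change and the wetting energy add
up to [r f dc/dt] by the addition formulas for the contact angle
[theta_i = theta_e - theta_hat]. *)
Lemma energy_rate (t : R) : 0 < t ->
  Derive arc_energy t
  = - 2 * PI * (RInt (fun s => dissipation s t) 0 (len F t)
      + eta * sub_r B (cr F t) * contact_f_right gamma B F sigma t ^ 2
      + eta * sub_r B (cl F t) * contact_f_left gamma B F sigma t ^ 2).
Proof.
intros Ht.
rewrite (is_derive_unique _ _ _ (is_derive_energy t ltac:(lra))).
assert (Hlen := len_pos _ _ HF t ltac:(lra)).
destruct (contact_dom _ _ HF t ltac:(lra)) as [Hdl Hdr].
destruct (bc_right _ _ _ _ _ Hbc t ltac:(lra)) as [HrR _].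
destruct (bc_flux _ _ _ _ _ Hbc t ltac:(lra)) as [Hm0 HmL].
destruct (contact_velocity_right t Ht) as [Hvr Hvz].
destruct (film_tangent _ _ HF (len F t) t) as [Hrs Hzs]; try lra.
rewrite Hrs in Hvr. rewrite Hzs in Hvz.
assert (Hdiss := ex_RInt_dissipation t ltac:(lra)).
assert (Hrate : ex_RInt (fun s => energy_density_rate s t) 0 (len F t)).
{ apply RInt_film; [lra|]. intros s Hs.
  apply (locally_2d_singleton _ _ _ (energy_density_regular s t ltac:(lra) Hs)). }
assert (Hbal := energy_balance t Ht).
assert (Hsum := RInt_plus (V := R_CompleteNormedModule) _ _ _ _ Hrate Hdiss).
change (RInt (fun s => energy_density_rate s t + dissipation s t) 0 (len F t)
  = RInt (fun s => energy_density_rate s t) 0 (len F t)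
    + RInt (fun s => dissipation s t) 0 (len F t)) in Hsum.
rewrite Hsum in Hbal.
assert (Hright : energy_flux (len F t) t + energy_density (len F t) t * D2 (arc F) 1 t
    - sigma * (sub_r B (cr F t) * Derive (cr F) t)
  = - eta * sub_r B (cr F t) * contact_f_right gamma B F sigma t ^ 2).
{ transitivity (sub_r B (cr F t) * (contact_f_right gamma B F sigma t * Derive (cr F) t)).
  2:{ rewrite (bc_angle_right _ _ _ _ _ Hbc t) by lra. ring. }
  unfold energy_flux, energy_density, tangential_speed, normal_speed. rewrite HmL, HrR.
  unfold contact_f_right, contact_f. rewrite cos_minus, sin_minus.
  assert (E : D2 (r F) (len F t) t = cos (sub_theta B (cr F t)) * Derive (cr F) t
    - cos (theta F (len F t) t) * D2 (arc F) 1 t) by lra.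
  assert (E' : D2 (z F) (len F t) t = sin (sub_theta B (cr F t)) * Derive (cr F) t
    - sin (theta F (len F t) t) * D2 (arc F) 1 t) by lra.
  rewrite E, E'.
  generalize (sin2_cos2 (theta F (len F t) t)). unfold Rsqr. intros Hsc.
  (* the two sides differ by a multiple of 1 - sin^2 - cos^2 *)
  match goal with |- ?a = ?b => enough (a - b = sub_r B (cr F t)
    * gamma (theta F (len F t) t) * D2 (arc F) 1 t
    * (1 - (sin (theta F (len F t) t) * sin (theta F (len F t) t)
            + cos (theta F (len F t) t) * cos (theta F (len F t) t)))) as H
    by (rewrite Hsc in H; lra) end.
  ring. }
assert (Hleft : energy_flux 0 t - sigma * (sub_r B (cl F t) * Derive (cl F) t)
  = eta * sub_r B (cl F t) * contact_f_left gamma B F sigma t ^ 2).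
{ unfold energy_flux. rewrite Hm0.
  destruct (bc_left _ _ _ _ _ Hbc t ltac:(lra)) as [[Hpos [HrL _]]|[HrL [_ HcL]]].
  - destruct (contact_velocity_left t Ht Hpos) as [Hvl Hvl'].
    transitivity (sub_r B (cl F t) * (contact_f_left gamma B F sigma t * Derive (cl F) t)).
    2:{ rewrite (bc_angle_left _ _ _ _ _ Hbc t) by lra. ring. }
    unfold tangential_speed, normal_speed, contact_f_left, contact_f.
    rewrite cos_minus, sin_minus, Hvl, Hvl', HrL. ring.
  - rewrite HrL, HcL. ring. }
replace (RInt (fun s => energy_density_rate s t) 0 (len F t)) with
  (energy_flux (len F t) t - energy_flux 0 t
   - RInt (fun s => dissipation s t) 0 (len F t)) by lra.
transitivity (2 * PI *
  ((energy_flux (len F t) t + energy_density (len F t) t * D2 (arc F) 1 t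
    - sigma * (sub_r B (cr F t) * Derive (cr F) t))
   - (energy_flux 0 t - sigma * (sub_r B (cl F t) * Derive (cl F) t))
   - RInt (fun s => dissipation s t) 0 (len F t))); [ring|].
rewrite Hright, Hleft. ring.
Qed.

Lemma energy_rate_nonpos (t : R) : 0 < t -> Derive arc_energy t <= 0.
Proof.
intros Ht. rewrite energy_rate by exact Ht.
assert (Hlen := len_pos _ _ HF t ltac:(lra)).
destruct (contact_dom _ _ HF t ltac:(lra)) as [Hdl Hdr].
assert (Hge : 0 <= RInt (fun s => dissipation s t) 0 (len F t)).
{ apply RInt_ge_0; [lra|apply ex_RInt_dissipation; lra|]. intros s Hs.
  apply Rmult_le_pos; [|apply pow2_ge_0].
  apply Rlt_le, (film_half_plane _ _ HF); lra. }
assert (Hend : forall c f, sub_dom B c -> 0 <= eta * sub_r B c * f ^ 2).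
{ intros c f Hc. apply Rmult_le_pos; [|apply pow2_ge_0].
  apply Rmult_le_pos; [lra|now apply (sub_half_plane _ HB)]. }
assert (Hcr := Hend _ (contact_f_right gamma B F sigma t) Hdr).
assert (Hcl := Hend _ (contact_f_left gamma B F sigma t) Hdl).
assert (Hpi := PI_RGT_0).
match goal with |- _ * ?x <= 0 =>
  assert (Hx : 0 <= PI * x) by (apply Rmult_le_pos; lra); lra end.
Qed.

Lemma volume_constant (t : R) : 0 <= t -> volume B F t = volume B F 0.
Proof.
intros [Ht| <-]; [|reflexivity].
rewrite !volume_arc_volume by lra. apply Rminus_diag_uniq.
destruct (mean_value arc_volume 0 t) as [c [Hc ->]]; [|exact Ht|].
- intros v Hv. eexists. apply is_derive_volume. lra.
- rewrite volume_rate_zero by lra. apply Rmult_0_l.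
Qed.

Lemma energy_nonincreasing (a b : R) : 0 <= a -> a <= b ->
  energy gamma B F sigma b <= energy gamma B F sigma a.
Proof.
intros Ha [Hab| <-]; [|apply Rle_refl].
rewrite !energy_arc_energy by lra. apply Rminus_le.
destruct (mean_value arc_energy a b) as [c [Hc ->]]; [|exact Hab|].
- intros v Hv. eexists. apply is_derive_energy. lra.
- assert (Hd := energy_rate_nonpos c ltac:(lra)).
  generalize (Rmult_le_compat_r (b - a) _ _ ltac:(lra) Hd). now rewrite Rmult_0_l.
Qed.

End Film.

Theorem mainTheorem1 (gamma : R -> R) (B : substrate) (F : film) (eta sigma : R)
  (Hgamma : surface_energy gamma) (Heta : 0 < eta)
  (HB : is_substrate B) (HF : is_film B F)
  (Heq : evolution_equations gamma F)
  (Hbc : boundary_conditions gamma B F eta sigma) :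
  (forall t, 0 <= t -> volume B F t = volume B F 0) /\
  (forall t1 t2, 0 <= t1 -> t1 <= t2 ->
     energy gamma B F sigma t2 <= energy gamma B F sigma t1 /\
     energy gamma B F sigma t1 <= energy gamma B F sigma 0).
Proof.
split.
- intros t Ht. now apply (volume_constant gamma B F eta sigma).
- intros t1 t2 H1 H12. split;
    apply (energy_nonincreasing gamma B F eta sigma); trivial; lra.
Qed.
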